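(* Let $X$ be a perfect compact metrizable space, $T$ a minimal homeomorphism of $X$, $G$ a locally compact second countable group, and $f:X\to G$ a continuous recurrent cocycle. Then $f$ is regular if and only if it is generically regular.
   Context: $T$ minimal means that every $T$-orbit is dense in $X$. A map $f:X\to G$ defines a $\mathbb Z$-cocycle by $f(n,x)=f(T^{n-1}x)\cdots f(Tx)f(x)$ for $n\ge 1$, $f(0,x)=e$, and $f(n,x)=f(-n,T^nx)^{-1}$ for $n<0$. The skew product is the $\mathbb Z$-action on $X\times G$ given by $T_f^n(x,g)=(T^nx,f(n,x)g)$. The cocycle $f$ is recurrent if for every nonempty open $O\subset X\times G$ there is an integer $n\ne0$ with $T_f^nO\cap O\neq\varnothing$. Regular: there exists $(x_0,g_0)\in X\times G$ such that $\pi_X\big(\overline{T_f^{\mathbb Z}(x_0,g_0)}\big)=X$, where $\pi_X:X\times G\to X$ is the projection. Generically regular: modulo a meager subset of $X$, $f$ is Borel cohomologous to a Borel ergodic cocycle with values in a closed subgroup of $G$; that is, there are a $T$-invariant comeager Borel set $X_0\subset X$, a closed subgroup $H\subset G$ and a Borel map $b:X_0\to G$ such that $\varphi(x)=b(Tx)f(x)b(x)^{-1}\in H$ for all $x\in X_0$, and $\varphi$ is ergodic as an $H$-valued cocycle, i.e. every Borel subset of $X_0\times H$ invariant under the skew product $T_\varphi(x,h)=(Tx,\varphi(x)h)$ is either meager or comeager in $X_0\times H$. *)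

(* Defs.v *)
From HB Require Import structures.
From mathcomp Require Import all_boot all_order all_algebra.
From mathcomp Require Import all_classical all_reals all_analysis.

Set Implicit Arguments.
Unset Strict Implicit.
Unset Printing Implicit Defensive.

Local Open Scope classical_set_scope.
Local Open Scope group_scope.

(* The library has topological additive groups only (topologicalZmodType);
   this is the multiplicative, possibly non-commutative, analogue. *)
HB.structure Definition PreTopologicalGroup :=
  {G of Topological G & Group G}.

HB.mixin Record PreTopologicalGroup_isTopologicalGroup G
    of PreTopologicalGroup G := {
  mulg_continuous : continuous (fun p : G * G => p.1 * p.2) ;
  invg_continuous : continuous (fun g : G => g^-1)
}.

#[short(type="topologicalGroupType")]
HB.structure Definition TopologicalGroup :=
  {G of PreTopologicalGroup G & PreTopologicalGroup_isTopologicalGroup G}.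

Definition nowhere_dense (Y : topologicalType) (A : set Y) :=
  (closure A)° = set0.

Definition meager (Y : topologicalType) (A : set Y) :=
  exists2 F : nat -> set Y, (forall n, nowhere_dense (F n)) &
    A `<=` \bigcup_n F n.

Definition comeager (Y : topologicalType) (A : set Y) := meager (~` A).

Definition borel (Y : topologicalType) : set (set Y) :=
  <<s [set U | open U] >>.

(* A map D -> Z is represented by a function on Y whose values off D are
   irrelevant; as in the library's measurable_fun, for a Borel set D this is
   Borel measurability of its restriction to D. *)
Definition borel_map_on (Y Z : topologicalType) (D : set Y) (b : Y -> Z) :=
  forall V : set Z, borel V -> borel (D `&` b @^-1` V).

Record homeomorphism (X : topologicalType) := Homeomorphism {
  homeo_fun :> X -> X ;
  homeo_inv : X -> X ;
  homeoK : cancel homeo_fun homeo_inv ;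
  homeo_invK : cancel homeo_inv homeo_fun ;
  homeo_continuous : continuous homeo_fun ;
  homeo_inv_continuous : continuous homeo_inv
}.

Definition homeo_iter (X : topologicalType) (T : homeomorphism X)
    (n : int) : X -> X :=
  match n with
  | Posz k => iter k T
  | Negz k => iter k.+1 (homeo_inv T)
  end.

Definition minimal (X : topologicalType) (T : homeomorphism X) :=
  forall x : X, dense (range (fun n : int => homeo_iter T n x)).

Section Cocycles.
Context (X : topologicalType) (G : topologicalGroupType).
Implicit Types (T : homeomorphism X) (f phi b : X -> G).
Implicit Types (H : set G).

Fixpoint cocycle_nat T f (n : nat) (x : X) : G :=
  if n is m.+1 then f (iter m T x) * cocycle_nat T f m x else 1.

(* Negz k is the integer - (k + 1). *)
Definition cocycle T f (n : int) (x : X) : G :=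
  match n with
  | Posz k => cocycle_nat T f k x
  | Negz k => (cocycle_nat T f k.+1 (homeo_iter T (Negz k) x))^-1
  end.

Definition skew_product T f (n : int) (p : X * G) : X * G :=
  (homeo_iter T n p.1, cocycle T f n p.1 * p.2).

Definition recurrent T f :=
  forall O : set (X * G), open O -> O !=set0 ->
    exists n : int, n <> 0%R /\ (skew_product T f n @` O) `&` O !=set0.

Definition regular T f :=
  exists p0 : X * G,
    fst @` closure (range (fun n : int => skew_product T f n p0)) = [set: X].

Definition closed_subgroup H := closed H /\ group_closed [in H].

(* X0 `*` H is here the type of its points, with the subspace topology.
   For a T-invariant X0 and for phi mapping X0 to a subgroup H, it is stable
   under (x, h) |-> (T x, phi x * h), and each point y has exactly one
   successor z. *)
Definition ergodic_cocycle T (X0 : set X) H phi :=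
  forall B : set (set_type (X0 `*` H)),
    borel B ->
    (forall y z : set_type (X0 `*` H),
       \val z = (T (\val y).1, phi (\val y).1 * (\val y).2) ->
       (B y <-> B z)) ->
    meager B \/ comeager B.

Definition cohomologous T b f : X -> G := fun x => b (T x) * f x * (b x)^-1.

Definition generically_regular T f :=
  exists (X0 : set X) H b,
    [/\ [/\ borel X0, comeager X0 & T @^-1` X0 = X0],
        closed_subgroup H,
        borel_map_on X0 b,
        (forall x, X0 x -> H (cohomologous T b f x)) &
        ergodic_cocycle T X0 H (cohomologous T b f)].

End Cocycles.

(* Main.v *)
Require Import Defs.
From HB Require Import structures.
From mathcomp Require Import all_boot all_order all_algebra.
From mathcomp Require Import all_classical all_reals all_analysis.

(* Right translations of X x G commute with the skew product S.

   Suppose f is regular and let Y be an orbit closure of S that projects onto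
   X. Call x symmetric if, for all basic open A and B, it is not on the boundary
   of the open set of points x' such that the S-orbit of (x', 1) meets A x B.
   If x is symmetric and (x, g) lies in the orbit closure of p, then p lies in
   that of (x, g); so Y is the orbit closure of all its points over x, and the
   section of Y over x is a coset g H, where H is the stabilizer of Y under
   right translations. A section s of Y that is continuous on a comeager
   invariant set X0 of symmetric points makes the cocycle
   s(T x)^-1 f(x) s(x) take values in H, and conjugates its skew product on
   X0 x H to S on a part of Y, where every orbit is dense; transitivity and the
   Baire property of Borel sets give ergodicity.

   Conversely let phi = b(T x) f(x) b(x)^-1 be ergodic on X0 x H. The map
   Phi (x, h) = (x, b(x)^-1 h) carries the skew product of phi to S, so for W in
   a countable basis of X x G the preimage by Phi of the S-saturation of W is
   meager or comeager. Outside a meager set all the points Phi z therefore have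
   the same orbit closure. Its projection to X is an invariant countable union
   of closed sets which is not meager, so by minimality it is X. *)

Set Implicit Arguments.
Unset Strict Implicit.
Unset Printing Implicit Defensive.

Local Open Scope classical_set_scope.

(** * Countable bases, compact neighborhoods and projections along compact sets *)

Definition enumerated_basis (P : topologicalType) (B : nat -> set P) :=
  (forall n, open (B n)) /\
  forall (x : P) U, nbhs x U -> exists n, B n x /\ B n `<=` U.

Lemma second_countable_enumerated (P : topologicalType) :
  @second_countable P -> exists B : nat -> set P, enumerated_basis B.
Proof.
move=> [B /countable_injP[i iB] [oB bB]].
(* Injectivity of [i] on [B] makes this union a single basic set, or the empty set when [n] is not a
   code. *)
exists (fun n => \bigcup_(U in [set U | B U /\ i U = n]) U); split.
  by move=> n; apply: bigcup_open => U [/oB].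
move=> x U /bB[V [BV Vx] VU]; exists (i V); split; first by exists V.
by move=> y [W [BW iWV] Wy]; apply: VU; rewrite -(iB W V) ?inE.
Qed.

(** Local compactness gives some compact neighborhood [C]; regularity of [C] shrinks it into [U]. *)
Lemma locally_compact_nbhs (P : topologicalType) (x : P) (U : set P) :
  hausdorff_space P -> locally_compact [set: P] -> nbhs x U ->
  exists2 K, nbhs x K & [/\ compact K, closed K & K `<=` U].
Proof.
move=> hP lcP xU; have [C] := lcP x I; rewrite withinET => xC [cC clC].
have [V xV VU] := compact_regular hP cC xC xU.
exists (closure V `&` C).
  by apply: filterI => //; apply: filterS xV; exact: subset_closure.
split.
- by rewrite setIC; apply: compact_closedI => //; exact: closed_closure.
- by apply: closedI => //; exact: closed_closure.
- by move=> y [/VU].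
Qed.

Definition compact_basis (P : topologicalType) (K : nat -> set P) :=
  (forall n, compact (K n) /\ closed (K n)) /\
  forall (x : P) U, nbhs x U -> exists n, nbhs x (K n) /\ K n `<=` U.

Lemma compact_basis_exists (P : topologicalType) :
  hausdorff_space P -> locally_compact [set: P] -> @second_countable P ->
  exists K : nat -> set P, compact_basis K.
Proof.
move=> hP lcP /second_countable_enumerated[B [oB bB]].
(* Basic sets whose closure is not compact are replaced by [set0]. Those contained in a compact
   closed neighborhood survive, and they suffice. *)
exists (fun n => if `[<compact (closure (B n))>] then closure (B n)
                 else set0); split=> [n|x U xU].
  case: asboolP => [cBn|_]; last by split; [exact: compact0|exact: closed0].
  by split => //; exact: closed_closure.
have [K xK [cK clK KU]] := locally_compact_nbhs hP lcP xU.
have [n [Bnx BnK]] := bB _ _ xK; exists n.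
have clBnK : closure (B n) `<=` K.
  by apply: subset_trans clK; exact: closureS.
case: asboolP => [cBn|[]]; last first.
  by apply: (subclosed_compact _ cK clBnK); exact: closed_closure.
split; last exact: subset_trans clBnK KU.
by apply: filterS (@subset_closure _ _) _; apply: open_nbhs_nbhs; split.
Qed.

(** The tube lemma: over a point outside the projection, compactness of [K] turns local disjointness
    from [Y] into disjointness over a whole neighborhood of that point. *)
Lemma closed_proj_compact (P Q : topologicalType) (Y : set (P * Q))
    (K : set Q) :
  closed Y -> compact K -> closed [set x | exists2 g, K g & Y (x, g)].
Proof.
move=> clY /compact_near_coveringP cK; rewrite -openC openE => x /= nYx.
have := @cK _ (nbhs x) (fun x' g => ~ Y (x', g)) _ => /(_ _) covK.
have {covK} : \forall x' \near x, K `<=` (fun g => ~ Y (x', g)).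
  apply: covK => g Kg.
  have : nbhs (x, g) (~` Y).
    apply: open_nbhs_nbhs; split; first exact: closed_openC.
    by move=> Yxg; apply: nYx; exists g.
  case=> -[A B] /= [xA gB] AB; exists (B, A) => //= -[g' x'] /= [Bg' Ax'].
  exact: (AB (x', g')).
by apply: filterS => x' KnY [g Kg]; exact: KnY.
Qed.

(** * Meager sets, the Baire property and Borel sets *)

Section Meager.
Context (P : topologicalType).
Implicit Types A B U : set P.

Lemma nowhere_denseP A :
  nowhere_dense A <-> forall U, open U -> U `<=` closure A -> U = set0.
Proof.
split=> [A0 U oU UA|A0].
  rewrite -subset0 => x Ux; rewrite -A0; apply: filterS UA _.
  by apply: open_nbhs_nbhs; split.
by apply: A0; [exact: open_interior|exact: interior_subset].
Qed.

Lemma nowhere_dense0 : nowhere_dense (set0 : set P).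
Proof.
apply/nowhere_denseP => U _; rewrite closure0; by rewrite subset0.
Qed.

Lemma sub_meager A B : A `<=` B -> meager B -> meager A.
Proof. by move=> AB [F F0 BF]; exists F => //; exact: subset_trans BF. Qed.

Lemma nowhere_dense_meager A : nowhere_dense A -> meager A.
Proof. by move=> A0; exists (fun=> A) => // x Ax; exists 0%N. Qed.

Lemma bigcup_meager (I : countType) (A : I -> set P) :
  (forall i, meager (A i)) -> meager (\bigcup_i A i).
Proof.
move=> mA; have /choice[F FA] : forall i, exists F : nat -> set P,
    (forall n, nowhere_dense (F n)) /\ A i `<=` \bigcup_n F n.
  by move=> i; have [F] := mA i; exists F.
(* The doubly indexed family is enumerated by codes of pairs; a number coding no pair contributes
   [set0]. *)
exists (fun k => if unpickle k is Some (i, n) then F i n else set0).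
  move=> k; case: unpickle => [[i n]|]; last exact: nowhere_dense0.
  exact: (FA i).1.
by move=> x [i _ /(FA i).2[n _ Fx]]; exists (pickle (i, n)); rewrite ?pickleK.
Qed.

Lemma meagerU A B : meager A -> meager B -> meager (A `|` B).
Proof.
move=> mA mB.
apply: sub_meager (@bigcup_meager bool (fun b => if b then A else B) _).
  by move=> x [Ax|Bx]; [exists true|exists false].
by case.
Qed.

Lemma open_boundary_nowhere_dense U :
  open U -> nowhere_dense (closure U `\` U).
Proof.
move=> oU; apply/nowhere_denseP => V oV.
have clB : closed (closure U `\` U).
  by apply: closedI; [exact: closed_closure|exact: open_closedC].
move=> /subset_trans/(_ clB) VB; rewrite -subset0 => x Vx.
have [cUx _] := VB _ Vx.
have [y [Uy Vy]] := cUx V (open_nbhs_nbhs (conj oV Vx)).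
by have [_ /(_ Uy)] := VB _ Vy.
Qed.

Lemma closed_boundary_nowhere_dense A :
  closed A -> nowhere_dense (A `\` A°).
Proof.
move=> clA; apply/nowhere_denseP => V oV.
have clB : closed (A `\` A°).
  by apply: closedI => //; apply: open_closedC; exact: open_interior.
move=> /subset_trans/(_ clB) VB; rewrite -subset0 => x Vx.
have [_] := VB _ Vx; apply; apply: (@filterS _ _ _ V); first by move=> y /VB[].
exact: open_nbhs_nbhs.
Qed.

Definition baire_property A :=
  exists2 U, open U & meager (A `\` U) /\ meager (U `\` A).

(** The sets with the Baire property form a sigma-algebra that contains the open sets. *)
Lemma borel_baire_property A : borel A -> baire_property A.
Proof.
apply: smallest_sub A; last first.
  move=> U /= oU; exists U => //; rewrite setDv.
  by split; exact/nowhere_dense_meager/nowhere_dense0.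
split.
- exists set0; first exact: open0.
  by rewrite setD0; split; exact/nowhere_dense_meager/nowhere_dense0.
(* The complement of [U] need not be open; the exterior of [U] differs from it by a nowhere dense
   boundary only. *)
- move=> A [U oU [AU UA]]; rewrite setTD; exists (~` closure U).
    exact/closed_openC/closed_closure.
  split.
    apply: sub_meager (meagerU UA (nowhere_dense_meager
      (open_boundary_nowhere_dense oU))).
    move=> x [nAx /contrapT cUx]; have [Ux|nUx] := pselect (U x); first by left.
    by right.
  apply: sub_meager AU => x [ncUx /contrapT Ax]; split => // Ux.
  by apply: ncUx; exact: subset_closure.
- move=> A bA; have /choice[U UA] : forall n, exists U,
      [/\ open U, meager (A n `\` U) & meager (U `\` A n)].
    by move=> n; have [U oU []] := bA n; exists U.
  exists (\bigcup_n U n); first by apply: bigcup_open => n _; have [] := UA n.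
  split.
    apply: sub_meager (@bigcup_meager nat (fun n => A n `\` U n) _).
      move=> x [[n _ Ax] nUx]; exists n => //; split => // Ux.
      by apply: nUx; exists n.
    by move=> n; have [] := UA n.
  apply: sub_meager (@bigcup_meager nat (fun n => U n `\` A n) _).
    move=> x [[n _ Ax] nUx]; exists n => //; split => // Ux.
    by apply: nUx; exists n.
  by move=> n; have [] := UA n.
Qed.

Lemma borelC A : borel A -> borel (~` A).
Proof. by move=> bA; rewrite -setTD; exact: sigma_algebraCD. Qed.

Lemma borel_open U : open U -> borel U.
Proof. exact: sub_sigma_algebra. Qed.

Lemma borel_bigcup (I : countType) (A : I -> set P) :
  (forall i, borel (A i)) -> borel (\bigcup_i A i).
Proof.
move=> bA; rewrite (_ : \bigcup_i A i =
    \bigcup_k (if @unpickle I k is Some i then A i else set0)).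
  apply: sigma_algebra_bigcup => k.
  by case: unpickle => [i|]; [exact: bA|exact: sigma_algebra0].
apply/seteqP; split=> [x [i _ Ax]|x [k _]].
  by exists (pickle i); rewrite ?pickleK.
by case: unpickle => // i; exists i.
Qed.

Lemma borelI A B : borel A -> borel B -> borel (A `&` B).
Proof.
move=> bA bB; rewrite -(setCK (A `&` B)) setCI; apply: borelC.
rewrite (_ : _ `|` _ = \bigcup_(b : bool) (if b then ~` A else ~` B)).
  by apply: borel_bigcup => -[]; exact: borelC.
apply/seteqP; split=> [x [Ax|Bx]|x [[] _]]; [by exists true|by exists false|..].
  by left.
by right.
Qed.

End Meager.

(** * Borel maps, subspaces and products *)

Lemma borel_map_on_continuous (P Q : topologicalType) (D : set P) (b : P -> Q) :
  borel D -> (forall x, D x -> {for x, continuous b}) -> borel_map_on D b.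
Proof.
move=> bD cb; apply: smallest_sub; last first.
  (* The preimage of [W] need not be open, but continuity of [b] at the points of [D] puts those it
     contains in its interior. *)
  move=> W /= oW; rewrite (_ : _ `&` _ = D `&` (b @^-1` W)°).
    by apply: borelI => //; apply: borel_open; exact: open_interior.
  apply/seteqP; split=> [x [Dx Wx]|x [Dx /interior_subset //]].
  by split=> //; apply: cb => //; apply: open_nbhs_nbhs.
split => /=.
- by rewrite preimage_set0 setI0; exact: sigma_algebra0.
- move=> W bW; rewrite (_ : _ `&` _ = D `&` ~` (D `&` b @^-1` W)).
    by apply: borelI => //; exact: borelC.
  apply/seteqP; split=> x [Dx nWx]; split => //; first by move=> [_]; apply nWx.
  by split => // Wx; apply: nWx.
- move=> W bW; rewrite preimage_bigcup setI_bigcupr.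
  exact: sigma_algebra_bigcup.
Qed.

Lemma borel_preimage (P Q : topologicalType) (g : P -> Q) (A : set Q) :
  continuous g -> borel A -> borel (g @^-1` A).
Proof.
move=> cg; have bT : borel (setT : set P) by apply: borel_open; exact: openT.
by move=> /(borel_map_on_continuous bT (fun x _ => cg x)); rewrite setTI.
Qed.

Lemma subtype_continuous (P Q : topologicalType) (A : set P)
    (g : Q -> set_type A) :
  continuous (fun x => \val (g x)) -> continuous g.
Proof. by move=> cg; apply: continuous_comp_initial; exact: cg. Qed.

Lemma val_continuous (P : topologicalType) (A : set P) :
  continuous (fun x : set_type A => \val x).
Proof. exact: initial_continuous. Qed.

Lemma val1_continuous (P Q : topologicalType) (A : set (P * Q)) :
  continuous (fun z : set_type A => (\val z).1).
Proof.
move=> z; apply: (cvg_comp (fun z : set_type A => \val z) fst).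
  exact: val_continuous.
exact: cvg_fst.
Qed.

Lemma val2_continuous (P Q : topologicalType) (A : set (P * Q)) :
  continuous (fun z : set_type A => (\val z).2).
Proof.
move=> z; apply: (cvg_comp (fun z : set_type A => \val z) snd).
  exact: val_continuous.
exact: cvg_snd.
Qed.

Lemma setX_nbhs (P Q : topologicalType) (p : P * Q) (A : set P) (B : set Q) :
  nbhs p.1 A -> nbhs p.2 B -> nbhs p (A `*` B).
Proof. by move=> pA pB; exists (A, B). Qed.

Lemma setX_hausdorff (P Q : topologicalType) :
  hausdorff_space P -> hausdorff_space Q -> hausdorff_space (P * Q)%type.
Proof.
move=> hP hQ [x y] [x' y'] cl; congr pair.
- apply: hP => A B xA xB.
  have [||[a b] [[Aa _] [Ba _]]] := cl (A `*` setT) (B `*` setT);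
    last by exists a.
    by apply: setX_nbhs => //=; exact: filterT.
  by apply: setX_nbhs => //=; exact: filterT.
- apply: hQ => A B yA yB.
  have [||[a b] [[_ Ab] [_ Bb]]] := cl (setT `*` A) (setT `*` B);
    last by exists b.
    by apply: setX_nbhs => //=; exact: filterT.
  by apply: setX_nbhs => //=; exact: filterT.
Qed.

Lemma setX_closed (P Q : topologicalType) (A : set P) (B : set Q) :
  closed A -> closed B -> closed (A `*` B).
Proof.
move=> clA clB [x y] cl; split => /=.
- apply: clA => W xW.
  have [|[a b] [[/= Aa _] [Wa _]]] := cl (W `*` setT); last by exists a.
  by apply: setX_nbhs => //=; exact: filterT.
- apply: clB => W yW.
  have [|[a b] [[/= _ Bb] [_ Wb]]] := cl (setT `*` W); last by exists b.
  by apply: setX_nbhs => //=; exact: filterT.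
Qed.

Lemma setX_locally_compact (P Q : topologicalType) :
  locally_compact [set: P] -> locally_compact [set: Q] ->
  locally_compact [set: (P * Q)%type].
Proof.
move=> lP lQ [x y] _; have [A + [cA clA]] := lP x I; rewrite withinET => xA.
have [B + [cB clB]] := lQ y I; rewrite withinET => yB.
exists (A `*` B); first by rewrite withinET; exact: setX_nbhs.
by split; [exact: compact_setX|exact: setX_closed].
Qed.

Lemma compact_locally_compact (P : topologicalType) :
  compact [set: P] -> locally_compact [set: P].
Proof.
move=> cP x _; exists setT; first by rewrite withinET; exact: filterT.
by split => //; exact: closedT.
Qed.

(** The map [g] sends an open set contained in the closure of the preimage of [F n] to an open set
    contained in the closure of [F n], hence to [set0]. *)
Lemma meager_preimage (P Q : topologicalType) (g : P -> Q) (A : set Q) :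
  continuous g -> (forall U, open U -> open (g @` U)) ->
  meager A -> meager (g @^-1` A).
Proof.
move=> cg og [F F0 AF]; exists (fun n => g @^-1` F n); last first.
  by move=> x /AF[n _]; exists n.
move=> n; apply/nowhere_denseP => U oU UF.
have /nowhere_denseP/(_ (g @` U) (og _ oU)) := F0 n.
have gUF : g @` U `<=` closure (F n).
  move=> _ [x Ux <-] V /cg /(UF _ Ux)[y [Fy Vy]].
  by exists (g y).
by move=> /(_ gUF)/image_set0_set0.
Qed.

(** * Baire category in closed subspaces of locally compact Hausdorff spaces *)

Lemma baire_closed (P : topologicalType) (C O : set P) (F : nat -> set P) :
  hausdorff_space P -> locally_compact [set: P] -> closed C -> open O ->
  O `&` C !=set0 -> (forall n, closed (F n)) ->
  O `&` C `<=` \bigcup_n F n ->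
  exists n U, [/\ open U, U `<=` O, U `&` C !=set0 & U `&` C `<=` F n].
Proof.
move=> hP lcP clC oO OC0 clF OCF; apply: contrapT => nF.
(* If no [F n] contains a nonempty relatively open piece of [C] inside [O], nested open sets with
   compact closures can be chosen that meet [C] and avoid the [F n] one after the other. *)
pose good (U : set P) := open U /\ U `&` C !=set0.
have step n (U : set P) : good U /\ U `<=` O -> exists V : set P,
    [/\ good V /\ V `<=` O, closure V `<=` U `\` F n & compact (closure V)].
  move=> [[oU UC0] UO].
  have [x [Ux Cx] nFx] : exists2 x, (U `&` C) x & ~ F n x.
    apply: contrapT => h; apply: nF; exists n, U; split => // x UCx.
    by apply: contrapT => nFx; apply: h; exists x.
  have xUF : nbhs x (U `\` F n).
    apply: open_nbhs_nbhs; split => //.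
    by apply: openI => //; exact: closed_openC.
  have [K xK [cK clK KU]] := locally_compact_nbhs hP lcP xUF.
  have clKK : closure K° `<=` K.
    by apply: subset_trans clK; apply: closureS; exact: interior_subset.
  exists K°; split.
  - split.
      split; first exact: open_interior.
      by exists x; split => //; exact: nbhs_interior xK.
    by move=> y /interior_subset/KU[/UO].
  - exact: subset_trans KU.
  - by apply: subclosed_compact cK clKK; exact: closed_closure.
pose T := {U : set P | good U /\ U `<=` O}.
have /choice[next nextP] : forall nU : nat * T, exists V : T,
    closure (sval V) `<=` sval nU.2 `\` F nU.1 /\ compact (closure (sval V)).
  move=> [n [U gU]]; have [V [gV VU cV]] := step n U gU.
  by exists (exist _ V gV).
pose U0 : T := exist _ O (conj (conj oO OC0) (fun _ => id)).
pose V := fix V n := if n is m.+1 then next (m, V m) else U0.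
have VS n : closure (sval (V n.+1)) `<=` sval (V n) `\` F n.
  exact: (nextP (n, V n)).1.
have Vdec m n : (m <= n)%N -> sval (V n) `<=` sval (V m).
  elim: n => [|n IH]; first by rewrite leqn0 => /eqP ->.
  rewrite leq_eqVlt => /predU1P[->//|]; rewrite ltnS => /IH.
  by apply: subset_trans => x /(@subset_closure _ _) /VS[].
(* Compactness starts at stage 1: stage 0 is [O], whose closure is arbitrary. *)
have cV1 : compact (closure (sval (V 1%N))) by exact: (nextP (0%N, V 0%N)).2.
(* A cluster point of these traces lies in [C] and in every closure, so it avoids every [F n],
   although they cover [C] inside [O]. *)
pose Fl := filter_from setT (fun n => sval (V n) `&` C).
have FlP : ProperFilter Fl.
  apply: filter_from_proper.
    apply: filter_from_filter; first by exists 0%N.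
    move=> i j _ _; exists (maxn i j) => // x [Vx Cx].
    by split; split => //; apply: Vdec Vx; rewrite ?leq_maxl ?leq_maxr.
  by move=> n _; have [[_ VC0] _] := svalP (V n).
have [|x [_ clx]] := cV1 Fl FlP.
  by exists 1%N => // x [Vx _]; exact: subset_closure.
have xV n : closure (sval (V n)) x.
  move=> B xB; have [|y [Vy By]] := clx (sval (V n)) B _ xB.
    by exists n => // y [].
  by exists y.
have Cx : C x.
  apply: clC => B xB; apply: clx => //; by exists 0%N => // y [].
have [n _ Fx] : (\bigcup_n F n) x.
  by apply: OCF; split => //; have [] := VS _ _ (xV 1%N).
by have [_] := VS _ _ (xV n.+1).
Qed.

Lemma baire_closed_countable (P : topologicalType) (I : countType)
    (C O : set P) (F : I -> set P) :
  hausdorff_space P -> locally_compact [set: P] -> closed C -> open O ->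
  O `&` C !=set0 -> (forall i, closed (F i)) ->
  O `&` C `<=` \bigcup_i F i ->
  exists i U, [/\ open U, U `<=` O, U `&` C !=set0 & U `&` C `<=` F i].
Proof.
move=> hP lcP clC oO OC0 clF OCF.
pose F' n := if @unpickle I n is Some i then F i else set0.
have [||n [U [oU UO UC0 UF]]] := @baire_closed P C O F' hP lcP clC oO OC0.
- by move=> n; rewrite /F'; case: unpickle => // ; exact: closed0.
- move=> x /OCF[i _ Fx]; exists (pickle i) => //.
  by rewrite /F' pickleK.
move: UF; rewrite /F'; case: unpickle => [i|] UF; first by exists i, U.
by have [x /UF] := UC0.
Qed.

(** A nonempty open set missing [A] would be covered by the closures of the nowhere dense [M n], and
    by Baire one of these would have interior points. *)
Lemma comeager_dense (P : topologicalType) (A : set P) :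
  hausdorff_space P -> locally_compact [set: P] -> comeager A -> dense A.
Proof.
move=> hP lcP [M M0 AM] O O0 oO; apply: contrapT => OA.
have [|||n [U [oU UO [x [Ux _]] UM]]] :=
    @baire_closed P setT O (fun n => closure (M n)) hP lcP closedT oO.
- by rewrite setIT.
- by move=> n; exact: closed_closure.
- move=> x [Ox _]; have [|n _ Mx] := AM x.
    by move=> Ax; apply: OA; exists x.
  by exists n => //; exact: subset_closure.
rewrite setIT in UM.
have /nowhere_denseP/(_ U oU UM) U0 := M0 n.
by rewrite U0 in Ux.
Qed.

(** * Orbit closures *)

Section Iterates.
Context (P : topologicalType) (S : homeomorphism P).
Implicit Types (m n : int) (p q : P).

Lemma homeo_iter1 p : homeo_iter S 1 p = S p. Proof. by []. Qed.

Lemma homeo_iterN1 p : homeo_iter S (- 1) p = homeo_inv S p.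
Proof. by []. Qed.

Lemma homeo_iterS n p : homeo_iter S (n + 1)%R p = S (homeo_iter S n p).
Proof.
case: n => [k|[|k]].
- by rewrite -[1%R]/(Posz 1) -PoszD addn1.
- by rewrite /= homeo_invK.
- have -> : (Negz k.+1 + 1)%R = Negz k.
    by rewrite !NegzE -(addn1 k.+1) PoszD GRing.opprD GRing.subrK.
  by rewrite /= homeo_invK.
Qed.

Lemma homeo_iterB1 n p :
  homeo_iter S (n - 1)%R p = homeo_inv S (homeo_iter S n p).
Proof. by rewrite -[in RHS](GRing.subrK 1%R n) homeo_iterS homeoK. Qed.

Lemma homeo_iterNS (n : nat) p :
  homeo_iter S (- n.+1%:Z)%R p = homeo_inv S (homeo_iter S (- n%:Z)%R p).
Proof. by rewrite -homeo_iterB1 -addn1 PoszD GRing.opprD. Qed.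

Lemma homeo_iterD m n p :
  homeo_iter S (m + n)%R p = homeo_iter S m (homeo_iter S n p).
Proof.
elim/int_rect: m => [|m IH|m IH]; first by rewrite GRing.add0r.
  by rewrite -addn1 PoszD GRing.addrAC !homeo_iterS IH.
by rewrite -addn1 PoszD GRing.opprD GRing.addrAC !homeo_iterB1 IH.
Qed.

Lemma homeo_iterK n : cancel (homeo_iter S n) (homeo_iter S (- n)%R).
Proof. by move=> p; rewrite -homeo_iterD GRing.addNr. Qed.

Lemma homeo_iterNK n : cancel (homeo_iter S (- n)%R) (homeo_iter S n).
Proof. by move=> p; rewrite -homeo_iterD GRing.addrN. Qed.

Lemma homeo_iter_continuous n : continuous (homeo_iter S n).
Proof.
elim/int_rect: n => [|n IH|n IH] p; first exact: cvg_id.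
  rewrite (_ : homeo_iter S n.+1 = S \o homeo_iter S n) //.
  by apply: continuous_comp; [exact: IH|exact: homeo_continuous].
rewrite (_ : homeo_iter S (- n.+1%:Z)%R =
    homeo_inv S \o homeo_iter S (- n%:Z)%R).
  by apply: continuous_comp; [exact: IH|exact: homeo_inv_continuous].
by apply/funext => q; exact: homeo_iterNS.
Qed.

Lemma homeo_iter_preimage n (A : set P) :
  homeo_iter S n @^-1` A = homeo_iter S (- n)%R @` A.
Proof.
apply/seteqP; split=> [p Ap|_ [p Ap <-]] /=; last by rewrite homeo_iterNK.
by exists (homeo_iter S n p) => //; rewrite homeo_iterK.
Qed.

Lemma homeo_iter_open n (A : set P) : open A -> open (homeo_iter S n @` A).
Proof.
rewrite -[n]GRing.opprK -homeo_iter_preimage => oA.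
by move/continuousP: (@homeo_iter_continuous (- n)%R); apply.
Qed.

Lemma homeo_iter_open_preimage n (A : set P) :
  open A -> open (homeo_iter S n @^-1` A).
Proof. by rewrite homeo_iter_preimage; exact: homeo_iter_open. Qed.

Lemma homeo_iter_meager n (A : set P) :
  meager A -> meager (homeo_iter S n @^-1` A).
Proof.
apply: meager_preimage; first exact: homeo_iter_continuous.
exact: homeo_iter_open.
Qed.

Lemma homeo_iter_invariant (A : set P) :
  (forall p, A (S p) <-> A p) -> forall n p, A (homeo_iter S n p) <-> A p.
Proof.
move=> SA; elim/int_rect=> [//|n IH|n IH] p; first by rewrite /= SA; exact: IH.
rewrite homeo_iterNS -[X in _ <-> X](IH p).
by rewrite -[in X in _ <-> X](homeo_invK S (homeo_iter S (- n%:Z)%R p)) SA.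
Qed.

(** The points whose orbit meets [A]; as [n] runs over all integers, images in place of preimages
    would give the same set. *)
Definition saturation (A : set P) : set P :=
  \bigcup_n (homeo_iter S n @^-1` A).

Lemma open_saturation (A : set P) : open A -> open (saturation A).
Proof.
by move=> oA; apply: bigcup_open => n _; exact: homeo_iter_open_preimage.
Qed.

Lemma saturation_homeo (A : set P) p : saturation A (S p) <-> saturation A p.
Proof.
split=> -[n _ /= Ap].
  by exists (n + 1)%R => //=; rewrite homeo_iterD.
by exists (n - 1)%R => //=; rewrite homeo_iterD homeo_iterN1 homeoK.
Qed.

(** Modulo a meager set, [B] is an open set [U]. If [U] is nonempty, its saturation is open and
    dense; by invariance, a point outside [B] is either in the nowhere dense boundary of this
    saturation or sent by an iterate into the meager set [U] minus [B]. *)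
Lemma transitive_baire_property (B : set P) :
  (forall U, open U -> U !=set0 -> dense (saturation U)) ->
  baire_property B -> (forall p, B (S p) <-> B p) ->
  meager B \/ comeager B.
Proof.
move=> dS [U oU [BU UB]] SB1.
have SB := homeo_iter_invariant SB1.
have [U0|U0] := pselect (U !=set0); last first.
  left; apply: sub_meager BU => p Bp; split => // Up.
  by apply: U0; exists p.
right; apply: sub_meager (meagerU (nowhere_dense_meager
  (open_boundary_nowhere_dense (open_saturation oU)))
  (bigcup_meager (fun n => homeo_iter_meager n UB))).
move=> p nBp; have [[n _ Up]|nsat] := pselect (saturation U p); [right|left].
  by exists n => //; split => //; rewrite /= SB.
split=> // A; rewrite nbhsE => -[A' [oA' A'p] A'A].
have [|q [A'q Uq]] := dS _ oU U0 A' _ oA'; first by exists p.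
by exists q; split => //; exact: A'A.
Qed.

Definition orbit_closure p := closure (range (fun n => homeo_iter S n p)).

Lemma orbit_closure_closed p : closed (orbit_closure p).
Proof. exact: closed_closure. Qed.

Lemma orbit_closureP p q :
  orbit_closure p q <-> forall U, nbhs q U -> exists n, U (homeo_iter S n p).
Proof.
split=> [cpq U /cpq[_ [[n _ <-] Up]]|cpq U /cpq[n Up]]; first by exists n.
by exists (homeo_iter S n p); split => //; exists n.
Qed.

Lemma orbit_closure_invariant p q n :
  orbit_closure p q -> orbit_closure p (homeo_iter S n q).
Proof.
move=> /orbit_closureP cpq; apply/orbit_closureP => U.
move=> /(@homeo_iter_continuous n)/cpq[m Up]; exists (n + m)%R.
by rewrite homeo_iterD.
Qed.

Lemma orbit_closure_sub p q :
  orbit_closure p q -> orbit_closure q `<=` orbit_closure p.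
Proof.
move=> cpq; rewrite {1}/orbit_closure => r cqr; apply: orbit_closure_closed.
apply: closureS cqr => _ [n _ <-]; exact: orbit_closure_invariant.
Qed.

End Iterates.

Lemma homeo_iter_semiconj (P Q : topologicalType) (S : homeomorphism P)
    (T : homeomorphism Q) (psi : P -> Q) :
  (forall p, psi (S p) = T (psi p)) ->
  forall n p, psi (homeo_iter S n p) = homeo_iter T n (psi p).
Proof.
move=> ST; elim/int_rect => [//|n IH|n IH] p; first by rewrite /= ST IH.
rewrite !homeo_iterNS -IH -[LHS](homeoK T) -ST.
by rewrite homeo_invK.
Qed.

(** * Invariant comeager Borel sets *)

Section InvariantCore.
Context (X : topologicalType) (T : homeomorphism X) (I : countType).
Context (D : I -> set X).

(** The largest invariant set contained in all the [D i]. *)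
Definition invariant_core : set X :=
  [set x | forall n i, D i (homeo_iter T n x)].

Lemma sub_invariant_core i : invariant_core `<=` D i.
Proof. by move=> x /(_ 0%R i). Qed.

Lemma invariant_core_preimage : T @^-1` invariant_core = invariant_core.
Proof.
apply/seteqP; split=> x Cx n i /=.
  by rewrite -[n](GRing.subrK 1%R) homeo_iterD; exact: Cx.
by rewrite -homeo_iter1 -homeo_iterD; exact: Cx.
Qed.

Lemma invariant_coreC :
  ~` invariant_core = \bigcup_n \bigcup_i (homeo_iter T n @^-1` ~` D i).
Proof.
apply/seteqP; split=> [x|x [n _ [i _ nDx]] /(_ n i)//].
move=> /existsNP[n /existsNP[i nDx]]; by exists n => //; exists i.
Qed.

Hypothesis oD : forall i, open (D i).

Lemma borel_invariant_core : borel invariant_core.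
Proof.
rewrite -(setCK invariant_core); apply: borelC; rewrite invariant_coreC.
apply: borel_bigcup => n; apply: borel_bigcup => i; rewrite preimage_setC.
by apply: borelC; apply: borel_open; exact: homeo_iter_open_preimage.
Qed.

Hypothesis mD : forall i, meager (~` D i).

Lemma comeager_invariant_core : comeager invariant_core.
Proof.
rewrite /comeager invariant_coreC.
apply: bigcup_meager => n; apply: bigcup_meager => i.
exact: homeo_iter_meager.
Qed.

End InvariantCore.

(** * The skew product as a homeomorphism, and its right translations *)

Section Skew.
Context (X : topologicalType) (G : topologicalGroupType).
Context (T : homeomorphism X) (f : X -> G).
Local Open Scope group_scope.

Lemma mulg_cvg (E : Type) (F : set_system E) (FF : Filter F)
    (u v : E -> G) a b :
  u @ F --> a -> v @ F --> b -> (u x * v x) @[x --> F] --> a * b.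
Proof.
move=> ua vb.
apply: (@continuous2_cvg _ _ _ _ _ _ _ _ (fun x y => x * y)) => //.
exact: (@mulg_continuous G (a, b)).
Qed.

Lemma invg_cvg (E : Type) (F : set_system E) (FF : Filter F) (u : E -> G) a :
  u @ F --> a -> (u x)^-1 @[x --> F] --> a^-1.
Proof. by apply: continuous_cvg; exact: invg_continuous. Qed.

Hypothesis fc : continuous f.

Let skew (p : X * G) := (T p.1, f p.1 * p.2).
Let skew_inv (p : X * G) := (homeo_inv T p.1, (f (homeo_inv T p.1))^-1 * p.2).

Let skewK : cancel skew skew_inv.
Proof. by move=> [x g]; rewrite /skew_inv /= homeoK mulKg. Qed.

Let skew_invK : cancel skew_inv skew.
Proof. by move=> [x g]; rewrite /skew /= homeo_invK mulVKg. Qed.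

Let skew_continuous : continuous skew.
Proof.
move=> p; apply: cvg_pair => /=.
  by apply: continuous_cvg; [exact: homeo_continuous|exact: cvg_fst].
apply: mulg_cvg; last exact: cvg_snd.
by apply: continuous_cvg; [exact: fc|exact: cvg_fst].
Qed.

Let skew_inv_continuous : continuous skew_inv.
Proof.
move=> p; have c1 : homeo_inv T q.1 @[q --> p] --> homeo_inv T p.1.
  by apply: continuous_cvg; [exact: homeo_inv_continuous|exact: cvg_fst].
apply: cvg_pair => //=; apply: mulg_cvg; last exact: cvg_snd.
by apply: invg_cvg; apply: continuous_cvg => //; exact: fc.
Qed.

Definition skew_homeo :=
  Homeomorphism skewK skew_invK skew_continuous skew_inv_continuous.

Lemma skew_homeoE x g : skew_homeo (x, g) = (T x, f x * g).
Proof. by []. Qed.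

Lemma skew_productE n : skew_product T f n =1 homeo_iter skew_homeo n.
Proof.
have pos k p : homeo_iter skew_homeo (Posz k) p =
    (iter k T p.1, cocycle_nat T f k p.1 * p.2).
  elim: k => [|k /= ->] /=; first by rewrite mul1g; case: p.
  by rewrite /skew /= mulgA.
case: n => k p; first by rewrite pos.
(* For a negative exponent, [k.+1] forward steps are applied to [skew_product T f (Negz k) p]: by
   [pos] the cocycle cancels its inverse and [p] comes back. *)
have := homeo_iterNK skew_homeo (Posz k.+1) (skew_product T f (Negz k) p).
have := homeo_iterK skew_homeo (Posz k.+1) (skew_product T f (Negz k) p).
rewrite -NegzE pos => <- _; congr homeo_iter; case: p => x g.
rewrite /skew_product [(_, _).1]/= [(_, _).2]/= /cocycle mulVKg; congr pair.
by rewrite NegzE -[iter _ _ _]/(homeo_iter T (Posz k.+1) _) homeo_iterNK.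
Qed.

Definition right_translation (h : G) (p : X * G) : X * G := (p.1, p.2 * h).

Lemma right_translation_continuous h : continuous (right_translation h).
Proof.
move=> p; apply: cvg_pair => /=; first exact: cvg_fst.
by apply: mulg_cvg; [exact: cvg_snd|exact: cvg_cst].
Qed.

Lemma right_translation_iter h n p :
  right_translation h (homeo_iter skew_homeo n p) =
  homeo_iter skew_homeo n (right_translation h p).
Proof.
apply: homeo_iter_semiconj => -[x g].
by rewrite skew_homeoE /right_translation /= -mulgA.
Qed.

Lemma homeo_iter_skew1 n p : (homeo_iter skew_homeo n p).1 = homeo_iter T n p.1.
Proof. by apply: (homeo_iter_semiconj (psi := fst)). Qed.

Lemma orbit_closure_right_translation h p q :
  orbit_closure skew_homeo p q ->
  orbit_closure skew_homeo (right_translation h p) (right_translation h q).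
Proof.
move=> /orbit_closureP cpq; apply/orbit_closureP => U.
move=> /(@right_translation_continuous h)/cpq[n Up]; exists n.
by rewrite -right_translation_iter.
Qed.

Lemma regularE : regular T f <->
  exists p, forall x, exists g, orbit_closure skew_homeo p (x, g).
Proof.
have rangeE p : range (fun n : int => skew_product T f n p) =
    range (fun n => homeo_iter skew_homeo n p).
  by apply: eq_imagel => n _; exact: skew_productE.
split=> -[p pX]; exists p.
  move=> x; have : [set: X] x by []. 
  by rewrite -pX => -[[y g]]; rewrite rangeE => cl /= <-; exists g.
rewrite rangeE; apply/seteqP; split=> // x _; have [g cl] := pX x.
by exists (x, g).
Qed.

End Skew.

Arguments orbit_closure_right_translation {X G T f fc} h [p q].

(** * Generically continuous selections *)

(* Along x, the n-th step keeps only the points of the n-th compact set of the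
   basis whenever some point of the section of Y over x survives; in the limit
   a single point survives. Each step is locally constant off the boundary of a
   closed set of x's, and membership in a compact set of the basis is decided in
   one step, whence continuity off countably many such boundaries. *)
Section GenericSelection.
Context (X Q : topologicalType) (K : nat -> set Q) (Y : set (X * Q)).
Hypothesis KP : compact_basis K.
Hypothesis clY : closed Y.
Hypothesis Y_total : forall x, exists g, Y (x, g).

(** The head of a word is the latest decision, so [size v] is the number of the step at which it was
    taken. *)
Fixpoint cell (w : seq bool) : set Q :=
  if w is b :: v then cell v `&` (if b then K (size v) else setT) else setT.

Let meets (w : seq bool) : set X := [set x | exists2 g, cell w g & Y (x, g)].

Let cellP w : closed (cell w) /\ (compact (cell w) \/ cell w = setT).
Proof.
elim: w => [|[] w [clw cw]] /=.
- by split; [exact: closedT|right].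
- have [cK clK] := KP.1 (size w); split; first exact: closedI.
  by left; rewrite setIC; exact: compact_closedI.
- by rewrite setIT.
Qed.

(** A compact cell falls under the projection lemma; the only other possible cell is the whole
    space, which meets every section by [Y_total]. *)
Let closed_meets w : closed (meets w).
Proof.
have [_ [cw|wT]] := cellP w; first exact: closed_proj_compact.
rewrite (_ : meets w = setT); first exact: closedT.
apply/seteqP; split => // x _; have [g Yg] := Y_total x.
by exists g; rewrite ?wT.
Qed.

Fixpoint itinerary (x : X) (n : nat) : seq bool :=
  if n is m.+1 then `[<meets (true :: itinerary x m) x>] :: itinerary x m
  else [::].

Let size_itinerary x n : size (itinerary x n) = n.
Proof. by elim: n => //= n ->. Qed.

Let itinerary_meets x n : meets (itinerary x n) x.
Proof.
elim: n => [|n [g wg Yg]] /=; first by have [g Yg] := Y_total x; exists g.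
case: asboolP => [//|_]; exists g => //=; by split.
Qed.

Let itinerary_sub x m n : (m <= n)%N ->
  cell (itinerary x n) `<=` cell (itinerary x m).
Proof.
elim: n => [|n IH]; first by rewrite leqn0 => /eqP ->.
rewrite leq_eqVlt => /predU1P[->//|]; rewrite ltnS => /IH.
by apply: subset_trans => g [].
Qed.

(** Otherwise every cell is the whole space. Some [K j] meets the section, so step [j] restricts to
    it, which forces the compact set [K j] to be the whole space. *)
Let itinerary_compact x : exists n, compact (cell (itinerary x n)).
Proof.
apply: contrapT => nc.
have wT n : cell (itinerary x n) = setT.
  have [_ [cw|//]] := cellP (itinerary x n).
  by exfalso; apply: nc; exists n.
have [g Yg] := Y_total x.
have [j [/nbhs_singleton Kg _]] := KP.2 g setT filterT.
have : cell (itinerary x j.+1) `<=` K j.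
  rewrite /= asboolT; last by exists g => //=; rewrite wT size_itinerary.
  by rewrite size_itinerary => h [].
rewrite wT => KT; apply: nc; exists j.+1; rewrite wT.
rewrite (_ : setT = K j); first exact: (KP.1 j).1.
by apply/seteqP.
Qed.

(** The cells cut the section in nested nonempty sets, eventually inside a compact one; a cluster
    point remains in all of them because [Y] and the cells are closed. *)
Let surviving_point x : exists g, Y (x, g) /\ forall n, cell (itinerary x n) g.
Proof.
have [k ck] := itinerary_compact x.
pose Fl := filter_from setT
  (fun n => [set g | cell (itinerary x n) g /\ Y (x, g)]).
have FlP : ProperFilter Fl.
  apply: filter_from_proper; last first.
    by move=> n _; have [g wg Yg] := itinerary_meets x n; exists g.
  apply: filter_from_filter; first by exists 0%N.
  move=> i j _ _; exists (maxn i j) => // g [wg Yg].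
  by split; split => //; apply: itinerary_sub wg; rewrite ?leq_maxl ?leq_maxr.
have [|g [_ clg]] := ck Fl FlP; first by exists k => // g [].
exists g; split.
  apply: clY => B [[B1 B2] /= [xB1 gB2] B12].
  have [|h [Yh B2h]] := clg [set h | Y (x, h)] B2 _ gB2.
    by exists 0%N => // h [].
  exists (x, h); split => //; apply: B12; split => //=.
  exact: nbhs_singleton.
move=> n; apply: (cellP _).1 => B gB; apply: clg => //.
by exists n => // h [].
Qed.

Lemma generic_selection : exists (D : seq bool -> set X) (s : X -> Q),
  [/\ forall w, open (D w), forall w, meager (~` D w),
      forall x, Y (x, s x) &
      forall x, (forall w, D w x) -> {for x, continuous s}].
Proof.
have /choice[s sP] := surviving_point.
exists (fun w => ~` (meets w `\` (meets w)°)), s; split.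
- move=> w; apply: closed_openC; apply: closedI; first exact: closed_meets.
  by apply: open_closedC; exact: open_interior.
- move=> w; rewrite setCK; apply: nowhere_dense_meager.
  exact/closed_boundary_nowhere_dense/closed_meets.
- by move=> x; have [] := sP x.
move=> x Dx.
have nearI n : \forall x' \near x, itinerary x' n = itinerary x n.
  elim: n => [|n IH]; first exact: nearW.
  set w := true :: itinerary x n.
  have : \forall x' \near x, meets w x' <-> meets w x.
    have [wx|nwx] := pselect (meets w x).
      have wox : nbhs x (meets w) by apply: contrapT => nwx; exact: (Dx w).
      by apply: filterS wox => x' wx'.
    have : nbhs x (~` meets w).
      by apply: open_nbhs_nbhs; split => //; exact: closed_openC.
    by apply: filterS => x' nwx'; split.
  apply: filterS2 IH => x' ex' /= ww; rewrite ex'; congr cons.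
  by apply/asbool_equiv_eq.
(* Since [s x] survives every step and lies in [K j], step [j] restricts to [K j]. Nearby
   itineraries agree through that step, so nearby values of [s] stay in [K j], inside [V]. *)
move=> V /KP.2[j [/nbhs_singleton Kj KjV]].
have KjE : cell (itinerary x j.+1) `<=` K j.
  rewrite /= asboolT; last first.
    have [Ys /(_ j) ws] := sP x.
    by exists (s x) => //=; rewrite size_itinerary.
  by rewrite size_itinerary => h [].
have := nearI j.+1; apply: filterS => x' ex'.
by apply/KjV/KjE; rewrite -ex'; exact: (sP x').2.
Qed.

End GenericSelection.

(** * Regular cocycles are generically regular *)

Section RegularToGeneric.
Context (X : topologicalType) (G : topologicalGroupType).
Context (T : homeomorphism X) (f : X -> G) (fc : continuous f).
Context (U : nat -> set X) (V K : nat -> set G).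
Hypothesis UB : enumerated_basis U.
Hypothesis VB : enumerated_basis V.
Hypothesis KB : compact_basis K.
Local Open Scope group_scope.
Local Notation S := (skew_homeo T fc).

Let visits i j : set X := [set x | saturation S (U i `*` V j) (x, 1)].

Let open_visits i j : open (visits i j).
Proof.
have oW : open (saturation S (U i `*` V j)).
  apply: open_saturation; rewrite openE => -[y g] [/= Uy Vg].
  by exists (U i, V j) => //; split; apply: open_nbhs_nbhs; split => //=;
    [exact: UB.1|exact: VB.1].
apply: (open_comp _ oW) => x _; apply: cvg_pair => /=; first exact: cvg_id.
exact: cvg_cst.
Qed.

Definition symmetric_point (x : X) :=
  forall ij : nat * nat,
    (~` (closure (visits ij.1 ij.2) `\` visits ij.1 ij.2)) x.

(** A translation reduces to [g = 1]. An iterate [r] of [q] near [(x, 1)], translated to second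
    coordinate 1, returns near [q] under the inverse iterate. So [x] is in the closure of
    [visits i j], and symmetry puts it in [visits i j] itself. *)
Lemma orbit_closure_sym x g p : symmetric_point x ->
  orbit_closure S p (x, g) -> orbit_closure S (x, g) p.
Proof.
move=> sx /(orbit_closure_right_translation g^-1).
rewrite /right_translation /= mulgV.
set q := (p.1, p.2 * g^-1) => cq.
suff : orbit_closure S (x, 1) q.
  move=> /(orbit_closure_right_translation g).
  by rewrite /right_translation /= mul1g mulgVK; case: p {q cq}.
apply/orbit_closureP => W [[A B] /= [qA qB] AB].
have [i [Ui UA]] := UB.2 _ _ qA; have [j [Vj VB']] := VB.2 _ _ qB.
suff [n _ [Un Vn]] : visits i j x.
  by exists n; apply: AB; split; [exact: UA|exact: VB'].
apply: contrapT => nvx; apply: (sx (i, j)); split => //= N xN.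
have [n [Nn Vn]] : exists n, N (homeo_iter S n q).1 /\
    V j (q.2 * (homeo_iter S n q).2^-1).
  move/orbit_closureP : cq => /(_ [set r | N r.1 /\ V j (q.2 * r.2^-1)]).
  apply; apply: filterI.
    by apply: (@cvg_fst _ _ (nbhs x) (nbhs (1 : G)) _).
  have : (q.2 * r.2^-1) @[r --> (x, 1 : G)] --> q.2 * 1^-1.
    by apply: mulg_cvg; [exact: cvg_cst|apply: invg_cvg; exact: cvg_snd].
  apply; rewrite invg1 mulg1; apply: open_nbhs_nbhs; split => //.
  exact: VB.1.
exists (homeo_iter S n q).1; split => //; exists (- n)%R => //.
set r := homeo_iter S n q in Nn Vn *.
have -> : (r.1, 1 : G) = right_translation r.2^-1 r.
  by rewrite /right_translation mulgV.
by rewrite /preimage /= -right_translation_iter /r homeo_iterK.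
Qed.

Context (p0 : X * G).
Local Notation Y := (orbit_closure S p0).
Hypothesis Y_total : forall x, exists g, Y (x, g).

(** Stability under [h] alone would only define a semigroup; requiring it of [h^-1] as well gives a
    group. *)
Let H : set G :=
  [set h | forall x g, Y (x, g) -> Y (x, g * h) /\ Y (x, g * h^-1)].

Let orbit_closureE x g : symmetric_point x -> Y (x, g) ->
  orbit_closure S (x, g) = Y.
Proof.
move=> sx Yg; apply/seteqP; split; first exact: orbit_closure_sub.
by apply: orbit_closure_sub; exact: orbit_closure_sym.
Qed.

Let closed_subgroup_H : closed_subgroup H.
Proof.
split.
  move=> h clh x g Yg; split.
    apply: (@orbit_closure_closed _ S p0) => W xW.
    have : (x, g * k) @[k --> h] --> (x, g * h).
      apply: cvg_pair => /=; first exact: cvg_cst.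
      by apply: mulg_cvg; [exact: cvg_cst|exact: cvg_id].
    move=> /(_ _ xW)/clh[k [/(_ _ _ Yg)[Yk _] Wk]].
    by exists (x, g * k).
  apply: (@orbit_closure_closed _ S p0) => W xW.
  have : (x, g * k^-1) @[k --> h] --> (x, g * h^-1).
    apply: cvg_pair => /=; first exact: cvg_cst.
    by apply: mulg_cvg; [exact: cvg_cst|apply: invg_cvg; exact: cvg_id].
  move=> /(_ _ xW)/clh[k [/(_ _ _ Yg)[_ Yk] Wk]].
  by exists (x, g * k^-1).
split.
  by rewrite inE => x g Yg; rewrite invg1 mulg1.
move=> h k; rewrite !inE => Hh Hk x g Yg.
have [Ygh _] := Hh _ _ Yg; have [Ygk _] := Hk _ _ Yg.
have [_ Y1] := Hk _ _ Ygh; have [_ Y2] := Hh _ _ Ygk.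
by rewrite !mulgA invgF -mulgA; split; rewrite ?mulgA.
Qed.

(** Right translation by [g^-1 * g'] takes [(x, g)] to [(x, g')], hence the orbit closure of the
    first to that of the second, and both are [Y]. *)
Let H_coset x g g' : symmetric_point x -> Y (x, g) -> Y (x, g') ->
  H (g^-1 * g').
Proof.
move=> sx; have half k k' : Y (x, k) -> Y (x, k') ->
    forall y l, Y (y, l) -> Y (y, l * (k^-1 * k')).
  move=> Yk Yk' y l; rewrite -{1}(orbit_closureE sx Yk).
  move=> /(orbit_closure_right_translation (k^-1 * k')).
  by rewrite /right_translation /= mulVKg (orbit_closureE sx Yk').
move=> Yg Yg' y l Yl; split; first exact: half.
by rewrite invgM invgK; exact: half.
Qed.

Lemma regular_generically_regular : generically_regular T f.
Proof.
have [D [s [oD mD sY sc]]] :=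
  generic_selection KB (@orbit_closure_closed _ S p0) Y_total.
(* A single countable family encodes continuity of [s] and symmetry, so that one invariant core
   provides both. *)
pose E (i : seq bool + nat * nat) : set X :=
  match i with
  | inl w => D w
  | inr ij => ~` (closure (visits ij.1 ij.2) `\` visits ij.1 ij.2)
  end.
have oE i : open (E i).
  case: i => [w|ij] /=; first exact: oD.
  apply: closed_openC; apply: closedI; first exact: closed_closure.
  exact: open_closedC.
have mE i : meager (~` E i).
  case: i => [w|ij] /=; first exact: mD.
  rewrite setCK; apply/nowhere_dense_meager/open_boundary_nowhere_dense.
  exact: open_visits.
pose X0 := invariant_core T E.
have X0sym x : X0 x -> symmetric_point x.
  by move=> X0x ij; exact: (@sub_invariant_core _ T _ E (inr ij) x X0x).
have X0sc x : X0 x -> {for x, continuous s}.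
  move=> X0x; apply: sc => w.
  exact: (@sub_invariant_core _ T _ E (inl w) x X0x).
have TX0 : T @^-1` X0 = X0 := invariant_core_preimage T E.
have X0T x : X0 x -> X0 (T x) by rewrite -{1}TX0.
have X0Ti x : X0 x -> X0 (homeo_inv T x).
  by rewrite -{2}TX0 /= homeo_invK.
pose b x := (s x)^-1.
pose phi := cohomologous T b f.
have phiE x : phi x = (s (T x))^-1 * (f x * s x).
  by rewrite /phi /cohomologous /b invgK mulgA.
have Yskew x g : Y (x, g) -> Y (T x, f x * g).
  by move=> /(@orbit_closure_invariant _ S _ _ 1%R).
(* Both [s (T x)] and [f x * s x] lie in the section of [Y] over the symmetric point [T x]. *)
have Hphi x : X0 x -> H (phi x).
  move=> X0x; rewrite phiE; apply: (H_coset (X0sym _ (X0T _ X0x))) => //.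
  exact: Yskew.
have [H1 HB] := closed_subgroup_H.2.
have HV := group_closedV (conj H1 HB).
have HM := group_closedM (conj H1 HB).
have HVP h : H h -> H h^-1 by move/mem_set/HV/set_mem.
have HMP h k : H h -> H k -> H (h * k).
  by move=> /mem_set Hh /mem_set Hk; apply: set_mem; exact: HM.
have phic x : X0 x -> {for x, continuous phi}.
  move=> X0x; rewrite (funext phiE : phi = fun x => (s (T x))^-1 * (f x * s x)).
  apply: mulg_cvg; last by apply: mulg_cvg; [exact: fc|exact: X0sc].
  apply: invg_cvg; apply: continuous_cvg; first exact/X0sc/X0T.
  exact: homeo_continuous.
have bX0 : borel X0 by exact: borel_invariant_core.
exists X0, H, b; split => //.
- by split => //; exact: comeager_invariant_core.
- apply: borel_map_on_continuous => // x X0x.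
  by apply: invg_cvg; exact: X0sc.
pose Z : topologicalType := set_type (X0 `*` H).
have ZP (z : Z) : X0 (\val z).1 /\ H (\val z).2.
  exact: set_mem (valP z).
(* The skew product of [phi] is made into a homeomorphism [Tau] of [Z], to which
   [transitive_baire_property] applies. Continuity of [phi] at the points of [X0] is enough, as [X0]
   is invariant. *)
have /choice[tau tauE] (z : Z) :
    exists z' : Z,
    \val z' = (T (\val z).1, phi (\val z).1 * (\val z).2).
  have [X0z Hz] := ZP z.
  have z'P : (X0 `*` H) (T (\val z).1, phi (\val z).1 * (\val z).2).
    by split => /=; [exact: X0T|apply: HMP => //; exact: Hphi].
  by exists (SigSub (mem_set z'P)).
pose Ti := homeo_inv T.
have /choice[taui tauiE] (z : Z) :
    exists z' : Z,
    \val z' = (Ti (\val z).1, (phi (Ti (\val z).1))^-1 * (\val z).2).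
  have [X0z Hz] := ZP z.
  have z'P : (X0 `*` H) (Ti (\val z).1, (phi (Ti (\val z).1))^-1 * (\val z).2).
    by split => /=; [exact: X0Ti|apply: HMP => //; apply/HVP/Hphi/X0Ti].
  by exists (SigSub (mem_set z'P)).
have tauK : cancel tau taui.
  move=> z; apply: val_inj; rewrite tauiE tauE /= /Ti homeoK mulKg.
  by case: (val z).
have tauiK : cancel taui tau.
  move=> z; apply: val_inj; rewrite tauE tauiE /= /Ti homeo_invK mulVKg.
  by case: (val z).
have cval2 (z : Z) : (\val z').2 @[z' --> z] --> (\val z).2.
  exact: val2_continuous.
have cu1 (u : X -> X) (z : Z) :
    continuous u -> u (\val z').1 @[z' --> z] --> u (\val z).1.
  move=> cu; apply: (cvg_comp (fun z : Z => (\val z).1) u); last exact: cu.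
  exact: val1_continuous.
have cphi (u : X -> X) (z : Z) : continuous u -> X0 (u (\val z).1) ->
    phi (u (\val z').1) @[z' --> z] --> phi (u (\val z).1).
  move=> cu X0u; apply: (cvg_comp (fun z : Z => u (\val z).1) phi).
    exact: cu1.
  exact: phic.
have ctau : continuous tau.
  apply: subtype_continuous; rewrite (funext tauE) => z.
  have [X0z _] := ZP z.
  have c1 := cu1 T z (@homeo_continuous _ T).
  have c2 := cphi id z (fun _ => cvg_id) X0z.
  exact: (cvg_pair c1 (mulg_cvg (nbhs_filter z) c2 (cval2 z))).
have ctaui : continuous taui.
  apply: subtype_continuous; rewrite (funext tauiE) => z.
  have [/X0Ti X0z _] := ZP z.
  have c1 := cu1 Ti z (@homeo_inv_continuous _ T).
  have c3 := cphi Ti z (@homeo_inv_continuous _ T) X0z.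
  have c2 := invg_cvg (nbhs_filter z) c3.
  exact: (cvg_pair c1 (mulg_cvg (nbhs_filter z) c2 (cval2 z))).
pose Tau := Homeomorphism tauK tauiK ctau ctaui.
move=> B bB B_inv; apply: (@transitive_baire_property _ Tau).
(* Every [z] is in the saturation of [W]: [Psi] conjugates [Tau] to [S] on a part of [Y], where the
   orbit of [Psi z] comes arbitrarily close to [Psi z1]. *)
- move=> W oW [z1 Wz1] O [z Oz] oO; exists z; split => //.
  pose Psi (z : Z) := ((\val z).1, s (\val z).1 * (\val z).2).
  have PsiE z' : Psi (Tau z') = S (Psi z').
    have sphi x h : s (T x) * (phi x * h) = f x * (s x * h).
      by rewrite phiE !mulgA mulgV mul1g.
    by rewrite /Psi /= tauE /= sphi.
  have YPsi z' : Y (Psi z').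
    by have [_ Hz'] := ZP z'; have [] := Hz' _ _ (sY (\val z').1).
  have z0 : orbit_closure S (Psi z) (Psi z1).
    have [X0z _] := ZP z.
    by rewrite /Psi (orbit_closureE (X0sym _ X0z) (YPsi z)); exact: YPsi.
  (* A left inverse of [Psi], continuous at [Psi z1], brings this closeness back to [Z]. *)
  pose Theta (p : X * G) := (p.1, (s p.1)^-1 * p.2).
  have ThetaK z' : Theta (Psi z') = \val z'.
    by rewrite /Theta /Psi /= mulKg; case: (val z').
  have cTheta : {for Psi z1, continuous Theta}.
    apply: cvg_pair => /=; first exact: cvg_fst.
    apply: mulg_cvg; last exact: cvg_snd.
    apply: invg_cvg; apply: continuous_cvg; last exact: cvg_fst.
    by apply: X0sc; have [] := ZP z1.
  move: oW => [W' oW' W'W]; rewrite -W'W in Wz1.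
  have : nbhs (Theta (Psi z1)) W'.
    by rewrite ThetaK; apply: open_nbhs_nbhs; split.
  move=> /cTheta; move/orbit_closureP : z0 => /[apply] -[n].
  rewrite /= -(homeo_iter_semiconj PsiE) ThetaK => W'n.
  by exists n => //=; rewrite -W'W.
- exact: borel_baire_property.
- by move=> z; have [] := B_inv _ _ (tauE z).
Qed.

End RegularToGeneric.

(** * Generically regular cocycles are regular *)

(* One half of the Kuratowski-Ulam theorem, for a non-closed first factor. *)
Lemma comeager_proj_nonmeager (X Q : topologicalType) (X0 : set X) (H : set Q)
    (N : set (set_type (X0 `*` H))) (E : nat -> set X) :
  hausdorff_space X -> locally_compact [set: X] ->
  hausdorff_space Q -> locally_compact [set: Q] ->
  [set: X] !=set0 -> comeager X0 -> closed H -> H !=set0 -> meager N ->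
  (forall n, closed (E n)) ->
  (forall z, ~ N z -> (\bigcup_n E n) (\val z).1) ->
  exists n U, [/\ open U, U !=set0 & U `<=` E n].
Proof.
move=> hX lX hQ lQ [x0 _] mX0 clH [h0 Hh0] [F F0 NF] clE NE.
have dX0 := comeager_dense hX lX mX0; have [M M0 X0M] := mX0.
(* These closed sets cover [X x H]: the first kind takes care of [N], the second of the points over
   the complement of [X0], the third of the rest. By Baire one of them contains a relatively open
   piece, and only the third kind can. *)
pose R (i : (nat + nat) + nat) : set (X * Q) :=
  match i with
  | inl (inl n) => closure ((fun z : set_type _ => \val z) @` F n)
  | inl (inr n) => closure (M n) `*` setT
  | inr n => E n `*` setT
  end.
have clR i : closed (R i).
  case: i => [[n|n]|n] /=; first exact: closed_closure.
    by apply: setX_closed; [exact: closed_closure|exact: closedT].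
  by apply: setX_closed => //; exact: closedT.
have clC : closed ([set: X] `*` H) by exact: setX_closed.
have [||i [U [oU _ [[x h] [Uxh [_ /= Hh]]] UR]]] := @baire_closed_countable _
    ((nat + nat) + nat)%type _ setT R (setX_hausdorff hX hQ)
    (setX_locally_compact lX lQ) clC openT _ clR.
- by exists (x0, h0).
- move=> [x h] [_ [_ /= Hh]].
  have [X0x|/X0M[n _ Mx]] := pselect (X0 x); last first.
    by exists (inl (inr n)) => //; split => //=; exact: subset_closure.
  pose z : set_type (X0 `*` H) :=
    SigSub (mem_set (conj X0x Hh : (X0 `*` H) (x, h))).
  have [/NF[n _ Fz]|/NE[n _ Enx]] := pselect (N z); last by exists (inr n).
  by exists (inl (inl n)) => //; apply: subset_closure; exists z.
have : nbhs (x, h) U by apply: open_nbhs_nbhs.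
case=> -[A B] /= [xA hB] AB.
have AU x' : A x' -> (U `&` ([set: X] `*` H)) (x', h).
  by move=> Ax'; split => //; apply: AB; split => //=; exact: nbhs_singleton.
have A0 : A° !=set0 by exists x; exact: xA.
case: i UR => [[n|n]|n] UR.
(* Density of [X0] makes the trace of [U] on the subspace [X0 x H] nonempty, and this open trace
   would lie in the closure of the nowhere dense [F n]. *)
- exfalso; have [x' [/interior_subset/AU[Ux' [_ Hx']] X0x']] :=
    dX0 _ A0 (@open_interior _ A).
  pose z : set_type (X0 `*` H) :=
    SigSub (mem_set (conj X0x' Hx' : (X0 `*` H) (x', h))).
  pose V := (fun z : set_type (X0 `*` H) => \val z) @^-1` U.
  have oV : open V by exists U.
  have /nowhere_denseP/(_ _ oV) V0 := F0 n.
  suff /V0 V0' : V `<=` closure (F n).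
    by have : V z by []; rewrite V0'.
  move=> z' Uz' W; rewrite nbhsE => -[W' [[W1 oW1 W1W'] W'z'] W'W].
  have [_ Hz'] : (X0 `*` H) (\val z') by exact: set_mem (valP z').
  have [|_ [[z2 Fz2 <-] W1z2]] := UR (\val z') (conj Uz' (conj I Hz')) W1.
    by apply: open_nbhs_nbhs; split => //; rewrite -W1W' in W'z'.
  by exists z2; split => //; apply: W'W; rewrite -W1W'.
- exfalso; have AM : A° `<=` closure (M n).
    by move=> x' /interior_subset/AU/UR[].
  have /nowhere_denseP/(_ _ (@open_interior _ A) AM) A00 := M0 n.
  by have [x'] := A0; rewrite A00.
- exists n, A°; split => //; first exact: open_interior.
  by move=> x' /interior_subset/AU/UR[].
Qed.

Section GenericToRegular.
Context (X : topologicalType) (G : topologicalGroupType).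
Context (T : homeomorphism X) (f : X -> G) (fc : continuous f).
Context (U : nat -> set X) (V K : nat -> set G).
Hypothesis UB : enumerated_basis U.
Hypothesis VB : enumerated_basis V.
Hypothesis KB : compact_basis K.
Local Open Scope group_scope.
Local Notation S := (skew_homeo T fc).
Context (X0 : set X) (H : set G) (b : X -> G).
Hypothesis bb : borel_map_on X0 b.

Local Notation Z := (set_type (X0 `*` H)).

Definition untwist (z : Z) : X * G :=
  ((\val z).1, (b (\val z).1)^-1 * (\val z).2).

(** As [b] is only Borel, the preimage is written as a countable union of Borel boxes: those triples
    of basic sets for [x], [b x] and [h] that force [(x, (b x)^-1 * h)] into [O]. *)
Lemma untwist_borel (O : set (X * G)) : open O -> borel (untwist @^-1` O).
Proof.
move=> oO; pose box (c : nat * nat * nat) : set Z :=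
  [set z | U c.1.1 (\val z).1] `&`
  ((fun z : Z => (\val z).1) @^-1` (X0 `&` b @^-1` V c.1.2) `&`
   [set z | V c.2 (\val z).2]).
pose good (c : nat * nat * nat) := forall x u h,
  U c.1.1 x -> V c.1.2 u -> V c.2 h -> O (x, u^-1 * h).
have c1 := @val1_continuous _ _ (X0 `*` H).
have c2 := @val2_continuous _ _ (X0 `*` H).
rewrite (_ : _ @^-1` _ = \bigcup_c (if `[<good c>] then box c else set0)).
  apply: borel_bigcup => c; case: asboolP => _; last exact: sigma_algebra0.
  apply: borelI.
    by apply: (borel_preimage c1); apply: borel_open; exact: UB.1.
  apply: borelI.
    by apply: (borel_preimage c1); apply: bb; apply: borel_open; exact: VB.1.
  by apply: (borel_preimage c2); apply: borel_open; exact: VB.1.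
apply/seteqP; split=> z; last first.
  move=> [c _]; case: asboolP => // gc [Uz [[_ Vbz] Vz]].
  exact: gc.
move=> Oz.
have : (p.1, p.2.1^-1 * p.2.2) @[p --> ((\val z).1, (b (\val z).1, (\val z).2))]
    --> untwist z.
  apply: cvg_pair => /=; first exact: cvg_fst.
  apply: mulg_cvg; first apply: invg_cvg.
    by apply: (cvg_comp snd fst); [exact: cvg_snd|exact: cvg_fst].
  by apply: (cvg_comp snd snd); [exact: cvg_snd|exact: cvg_snd].
move=> /(_ _ (open_nbhs_nbhs (conj oO Oz)))[[A W] /=].
move=> [xA [[B C] /= [bB hC] BCW]] AWO.
have [i [Ui UA]] := UB.2 _ _ xA; have [j [Vj VB']] := VB.2 _ _ bB.
have [k [Vk VC]] := VB.2 _ _ hC.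
exists (i, j, k) => //; case: asboolP => [_|[]].
  by split => //; split => //; split => //; have [] := set_mem (valP z).
move=> x u h /= Ux Vu Vh; apply: (AWO (x, (u, h))).
split => /=; first exact: UA.
by apply: BCW; split; [exact: VB'|exact: VC].
Qed.

Hypothesis hX : hausdorff_space X.
Hypothesis lX : locally_compact [set: X].
Hypothesis hG : hausdorff_space G.
Hypothesis lG : locally_compact [set: G].
Hypothesis X_nonempty : [set: X] !=set0.
Hypothesis T_minimal : minimal T.
Hypothesis mX0 : comeager X0.
Hypothesis clH : closed_subgroup H.
Hypothesis erg : ergodic_cocycle T X0 H (cohomologous T b f).

Lemma generically_regular_orbit :
  exists p, forall x, exists g, orbit_closure S p (x, g).
Proof.
have H0 : H !=set0 by exists 1; have [] := clH.2; rewrite inE.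
pose Q (c : nat * nat) : set Z :=
  untwist @^-1` saturation S (U c.1 `*` V c.2).
have oW (c : nat * nat) : open (U c.1 `*` V c.2).
  rewrite openE => p [/= Up Vp].
  by apply: setX_nbhs; apply: open_nbhs_nbhs; split => //;
    [exact: UB.1|exact: VB.1].
have ergQ c : meager (Q c) \/ comeager (Q c).
  apply: erg; first by apply: untwist_borel; exact: open_saturation.
  move=> y z yz; rewrite /Q /preimage /=.
  have -> : untwist z = S (untwist y).
    rewrite /untwist yz /=; congr pair; rewrite /cohomologous /=.
    by rewrite !mulgA mulVg mul1g.
  by have [] := saturation_homeo S (U c.1 `*` V c.2) (untwist y).
(* For each box the meager one of [Q c] and its complement is discarded; outside [N], membership in
   [Q c] depends on [c] alone. *)
pose N : set Z := \bigcup_c (if `[<meager (Q c)>] then Q c else ~` Q c).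
have mN : meager N.
  by apply: bigcup_meager => c; case: asboolP => //; have [] := ergQ c.
have QE z z' c : ~ N z -> ~ N z' -> Q c z -> Q c z'.
  move=> Nz Nz' Qz; apply: contrapT => nQz'.
  have [mQ|nmQ] := pselect (meager (Q c)).
    by apply: Nz; exists c => //; rewrite asboolT.
  by apply: Nz'; exists c => //; rewrite asboolF.
(* If [N] were everything, the projection lemma with empty [E n] would put a nonempty open set
   inside [set0]. *)
have [z0 Nz0] : exists z0, ~ N z0.
  apply: contrapT => allN.
  have [||n [W [_ [x Wx] W0]]] := comeager_proj_nonmeager hX lX hG lG X_nonempty
      mX0 clH.1 H0 mN (E := fun=> set0).
  - by move=> n; exact: closed0.
  - by move=> z Nz; exfalso; apply: allN; exists z.
  by have := W0 _ Wx.
(* The point [untwist z] visits each box around itself at time 0, so the orbit of [untwist z0]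
   visits that box too. *)
have zcl z : ~ N z -> orbit_closure S (untwist z0) (untwist z).
  move=> Nz; apply/orbit_closureP => W [[A B] /= [xA gB] AB].
  have [i [Ui UA]] := UB.2 _ _ xA; have [j [Vj VB']] := VB.2 _ _ gB.
  have [|n _ /= [Un Vn]] := QE z z0 (i, j) Nz Nz0; first by exists 0%R.
  by exists n; apply: AB; split; [exact: UA|exact: VB'].
exists (untwist z0).
(* The projection of the orbit closure is cut into its parts over the compact sets [K n], each
   closed; one contains an open [W]. *)
have [||n [W [oW' [w Ww] WE]]] := comeager_proj_nonmeager hX lX hG lG X_nonempty
    mX0 clH.1 H0 mN
    (E := fun n => [set x |
      exists2 g, K n g & orbit_closure S (untwist z0) (x, g)]).
- move=> n; apply: closed_proj_compact; last exact: (KB.1 n).1.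
  exact: orbit_closure_closed.
- move=> z /zcl cz.
  have [n [/nbhs_singleton Kn _]] := KB.2 (untwist z).2 setT filterT.
  by exists n => //; exists (untwist z).2.
(* Minimality sends [x] into [W] by an iterate [m]; the iterate [- m] of [S] then moves a point of
   the orbit closure back over [x]. *)
move=> x; have [|_ [/[swap] [[m _ <-]] /WE[g _]]] := T_minimal x (O := W) _ oW'.
  by exists w.
move=> /(@orbit_closure_invariant _ S _ _ (- m)%R).
set p := homeo_iter S _ _ => cp; exists p.2.
suff -> : x = p.1 by case: p cp.
by rewrite /p homeo_iter_skew1 /= homeo_iterK.
Qed.

End GenericToRegular.

(** * Countable bases for the two spaces, and the equivalence *)

Lemma compact_metric_second_countable (R : realType) (X : metricType R) :
  [set: X] !=set0 -> compact [set: X] -> @second_countable X.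
Proof.
(* The point [x0] makes [X] a pointed space, the setting of [compact_second_countable]. *)
move=> [x0 _] cX; pose px := isPointed.Build X x0.
pose PX : pseudoPMetricType R := HB.pack (X : Type) (X : pseudoMetricType R) px.
exact: (@compact_second_countable R PX).
Qed.

Theorem proposition2p3 (R : realType) (X : metricType R)
    (G : topologicalGroupType) (T : homeomorphism X) (f : X -> G)
    (X_nonempty : [set: X] !=set0)
    (X_perfect : perfect_set [set: X])
    (X_compact : compact [set: X])
    (T_minimal : minimal T)
    (G_hausdorff : hausdorff_space G)
    (G_locally_compact : locally_compact [set: G])
    (G_second_countable : @second_countable G)
    (f_continuous : continuous f)
    (f_recurrent : recurrent T f) :
  regular T f <-> generically_regular T f.
Proof.
have [U UB] := second_countable_enumerated
  (compact_metric_second_countable X_nonempty X_compact).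
have [V VB] := second_countable_enumerated G_second_countable.
have [K KB] := compact_basis_exists G_hausdorff G_locally_compact
  G_second_countable.
split=> [/(regularE _ f_continuous)[p pX]|].
  exact: (regular_generically_regular UB VB KB pX).
move=> [X0 [H [b [[_ mX0 _] clH bb _ erg]]]].
apply/(regularE _ f_continuous).
exact: (generically_regular_orbit f_continuous UB VB KB bb
  (@metric_hausdorff _ X) (compact_locally_compact X_compact) G_hausdorff
  G_locally_compact X_nonempty T_minimal mX0 clH erg).
Qed.
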